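(* Let $f:\mathbb{R}^d\to\mathbb{R}$ be Lipschitz-smooth with constant $L>0$ and strongly convex with constant $m>0$, let $x^\ast$ be its minimizer, and let $Q=L/m$. Given initial points $x_0=y_0$, if the estimates $L_k$ of the Lipschitz constant in accelerated gradient descent (AGD) are generated monotonically by adaptive backtracking (ABLS, with $L_k$ serving as the initial estimate for $L_{k+1}$) for the Armijo condition with $c\in[1/2,1)$ and parameter $\rho\in(0,1)$, and $L_0>m$, then for $k\ge0$ $$f(y_{k+1})-f(x^\ast)\le\Biggl(\frac{\sqrt Q-\sqrt{2(1-c)\rho}}{\sqrt Q}\Biggr)^{k}\frac{Q^2}{4(1-c)^2\rho^2}\,\frac{L+m}{2}\,\|x_0-x^\ast\|^2 .$$
   Context: A differentiable $f$ is Lipschitz-smooth with constant $L>0$ if $f(y)\le f(x)+\langle\nabla f(x),y-x\rangle+\frac L2\|y-x\|^2$ for all $x,y$; a continuously differentiable $f$ is strongly convex with constant $m>0$ if $f(y)\ge f(x)+\langle\nabla f(x),y-x\rangle+\frac m2\|y-x\|^2$ for all $x,y$. AGD: for $k\ge0$, $$y_{k+1}=x_k-\frac1{L_k}\nabla f(x_k),\qquad \beta_k=\frac{\sqrt{L_k}-\sqrt m}{\sqrt{L_k}+\sqrt m},\qquad x_{k+1}=(1+\beta_k)y_{k+1}-\beta_k y_k .$$ The estimate is $L_k=1/\alpha_k$, where $\alpha_k$ is the step-size returned by ABLS at $x_k$ with direction $d_k=-\nabla f(x_k)$: start from a tentative step-size $\alpha>0$; while the Armijo condition $f(x_k+\alpha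 d_k)-f(x_k)\le c\,\alpha\langle\nabla f(x_k),d_k\rangle$ fails, set $\alpha\gets\hat\rho(v(\alpha))\,\alpha$, where $$v(\alpha)=\frac{f(x_k+\alpha d_k)-f(x_k)}{c\,\alpha\langle\nabla f(x_k),d_k\rangle},\qquad \hat\rho(v(\alpha))=\max\Bigl(\epsilon,\rho\frac{1-c}{1-c\,v(\alpha)}\Bigr),$$ and $\epsilon>0$ is a small constant such that $\hat\rho$ takes values in $(0,1)$; return $\alpha_k=\alpha$. ''Monotonically'' means that the tentative step-size from which ABLS starts at iteration $k+1$ is $1/L_k$, so that $L_{k+1}\ge L_k$.
   Formalization: The first tentative step-size is additionally assumed to be at least 2(1−c)ρ/L; without this the bound fails, e.g. for f(x)=x²/2, m=L=1, c=1/2, ρ=0.81, x_0=y_0=1, first tentative step 1/100, at k=2. *)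

(* Defs.v *)
From HB Require Import structures.
From mathcomp Require Import all_boot all_order all_algebra.
From mathcomp Require Import all_classical all_reals all_analysis.

Set Implicit Arguments.
Unset Strict Implicit.
Unset Printing Implicit Defensive.

Import Order.TTheory GRing.Theory Num.Theory.
Import numFieldNormedType.Exports.

Local Open Scope ring_scope.

(* The library norm `|u| on 'rV[R]_d is the sup norm, hence the Euclidean inner
   product and norm below; both norms induce the same topology, so the library
   notions of differentiability and continuity are the usual ones. *)
Definition dotv (R : realType) (d : nat) (u v : 'rV[R]_d) : R :=
  \sum_(i < d) u 0 i * v 0 i.

Definition normE (R : realType) (d : nat) (u : 'rV[R]_d) : R :=
  Num.sqrt (dotv u u).

Definition grad (R : realType) (d : nat) (f : 'rV[R]_d -> R) (x : 'rV[R]_d) :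
    'rV[R]_d :=
  \row_(i < d) 'D_(delta_mx 0 i) f x.

Definition lipschitz_smooth (R : realType) (d : nat) (f : 'rV[R]_d -> R)
    (L : R) : Prop :=
  (forall x, differentiable f x) /\
  forall x y,
    f y <= f x + dotv (grad f x) (y - x) + L / 2 * normE (y - x) ^+ 2.

Definition strongly_convex (R : realType) (d : nat) (f : 'rV[R]_d -> R)
    (m : R) : Prop :=
  [/\ forall x, differentiable f x,
      continuous (grad f) &
      forall x y,
        f x + dotv (grad f x) (y - x) + m / 2 * normE (y - x) ^+ 2 <= f y].

Definition armijo (R : realType) (d : nat) (f : 'rV[R]_d -> R) (c : R)
    (x dir : 'rV[R]_d) (a : R) : Prop :=
  f (x + a *: dir) - f x <= c * a * dotv (grad f x) dir.

Definition violation (R : realType) (d : nat) (f : 'rV[R]_d -> R) (c : R)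
    (x dir : 'rV[R]_d) (a : R) : R :=
  (f (x + a *: dir) - f x) / (c * a * dotv (grad f x) dir).

Definition rhohat (R : realType) (c rho eps v : R) : R :=
  Num.max eps (rho * ((1 - c) / (1 - c * v))).

(* [abls f c rho eps x dir a b]: the backtracking loop started from the
   tentative step-size [a] terminates and returns [b]. *)
Inductive abls (R : realType) (d : nat) (f : 'rV[R]_d -> R) (c rho eps : R)
    (x dir : 'rV[R]_d) : R -> R -> Prop :=
  | abls_stop (a : R) :
      armijo f c x dir a -> abls f c rho eps x dir a a
  | abls_shrink (a b : R) :
      ~ armijo f c x dir a ->
      abls f c rho eps x dir (rhohat c rho eps (violation f c x dir a) * a) b ->
      abls f c rho eps x dir a b.

(* The estimate [Lk k] is the inverse of the step-size returned at iteration
   [k]; the search starts from [s0] at iteration 0 and from [(Lk k)^-1] at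
   iteration [k.+1]. *)
Definition monotone_abls_estimates (R : realType) (d : nat)
    (f : 'rV[R]_d -> R) (c rho eps s0 : R) (x : nat -> 'rV[R]_d)
    (Lk : nat -> R) : Prop :=
  abls f c rho eps (x 0%N) (- grad f (x 0%N)) s0 (Lk 0%N)^-1 /\
  forall k : nat,
    abls f c rho eps (x k.+1) (- grad f (x k.+1)) (Lk k)^-1 (Lk k.+1)^-1.

Definition momentum (R : realType) (m l : R) : R :=
  (Num.sqrt l - Num.sqrt m) / (Num.sqrt l + Num.sqrt m).

Definition agd (R : realType) (d : nat) (f : 'rV[R]_d -> R) (m : R)
    (Lk : nat -> R) (x y : nat -> 'rV[R]_d) : Prop :=
  forall k : nat,
    y k.+1 = x k - (Lk k)^-1 *: grad f (x k) /\
    x k.+1 = (1 + momentum m (Lk k)) *: y k.+1 - momentum m (Lk k) *: y k.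

(* Main.v *)
(** Nesterov's Lyapunov argument with a varying condition number. Put
    [q k = sqrt (Lk k / m)]. With [w k = x k + q k (x k - y k)] and
    [z (k+1) = q k y (k+1) - (q k - 1) y k], one AGD step gives
      [f (y (k+1)) - f* + m/2 |z (k+1) - x*|^2
         <= (1 - 1 / q k) (f (y k) - f* + m/2 |w k - x*|^2)],
    because the Armijo condition with [c >= 1/2] yields the usual descent
    inequality. Replacing the estimate [Lk k] by [Lk (k+1)] turns [z (k+1)] into
    [w (k+1) = r z (k+1) - (r - 1) y (k+1)] with
    [r = (1 + q (k+1)) / (1 + q k) >= 1], which costs a factor of at most [r^4].
    These factors telescope to at most [(L / (2 (1 - c) rho m))^2], since
    backtracking never returns a step below [2 (1 - c) rho / L]. *)
Require Import Defs.
From HB Require Import structures.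
From mathcomp Require Import all_boot all_order all_algebra.
From mathcomp Require Import all_classical all_reals all_analysis.
From mathcomp Require Import ring lra.

Import Order.TTheory GRing.Theory Num.Theory.
Import numFieldNormedType.Exports.

Local Open Scope ring_scope.

(** * Algebra of the Euclidean inner product *)

Lemma dotvC {R : realType} {d : nat} (u v : 'rV[R]_d) : dotv u v = dotv v u.
Proof. by apply: eq_bigr => i _; rewrite mulrC. Qed.

Lemma dotvDl {R : realType} {d : nat} (u v w : 'rV[R]_d) :
  dotv (u + v) w = dotv u w + dotv v w.
Proof. by rewrite -big_split /=; apply: eq_bigr => i _; rewrite mxE mulrDl. Qed.

Lemma dotvZl {R : realType} {d : nat} (a : R) (u w : 'rV[R]_d) :
  dotv (a *: u) w = a * dotv u w.
Proof. by rewrite /dotv mulr_sumr; apply: eq_bigr => i _; rewrite mxE mulrA. Qed.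

Lemma dotvNl {R : realType} {d : nat} (u w : 'rV[R]_d) :
  dotv (- u) w = - dotv u w.
Proof. by rewrite -scaleN1r dotvZl mulN1r. Qed.

Lemma dotvDr {R : realType} {d : nat} (u v w : 'rV[R]_d) :
  dotv w (u + v) = dotv w u + dotv w v.
Proof. by rewrite dotvC dotvDl !(dotvC _ w). Qed.

Lemma dotvZr {R : realType} {d : nat} (a : R) (u w : 'rV[R]_d) :
  dotv w (a *: u) = a * dotv w u.
Proof. by rewrite dotvC dotvZl dotvC. Qed.

Lemma dotvNr {R : realType} {d : nat} (u w : 'rV[R]_d) :
  dotv w (- u) = - dotv w u.
Proof. by rewrite dotvC dotvNl dotvC. Qed.

Definition dotvE {R : realType} {d : nat} :=
  (@dotvDl R d, @dotvDr R d, @dotvNl R d, @dotvNr R d, @dotvZl R d,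
   @dotvZr R d).

Lemma dotvv_ge0 {R : realType} {d : nat} (u : 'rV[R]_d) : 0 <= dotv u u.
Proof. by apply: sumr_ge0 => i _; rewrite -expr2 sqr_ge0. Qed.

Lemma dotvv_eq0 {R : realType} {d : nat} (u : 'rV[R]_d) :
  dotv u u = 0 -> u = 0.
Proof.
move=> u0; apply/rowP => i; rewrite mxE.
have /psumr_eq0P h : forall j : 'I_d, true -> 0 <= u 0 j * u 0 j.
  by move=> j _; rewrite -expr2 sqr_ge0.
by apply/eqP; have := h u0 i isT => /eqP; rewrite mulf_eq0 orbb.
Qed.

Lemma normE_sqr {R : realType} {d : nat} (u : 'rV[R]_d) :
  normE u ^+ 2 = dotv u u.
Proof. by rewrite sqr_sqrtr // dotvv_ge0. Qed.

(** * Consequences of smoothness: descent, stationarity and backtracking steps *)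

Lemma lipschitz_smooth_step {R : realType} {d : nat} (f : 'rV[R]_d -> R)
    (L a : R) (x : 'rV[R]_d) : lipschitz_smooth f L ->
  f (x + a *: - grad f x) - f x
    <= - (a * (1 - L * a / 2)) * dotv (grad f x) (grad f x).
Proof.
move=> [_ /(_ x (x + a *: - grad f x))].
rewrite normE_sqr [x + _ - x]addrAC subrr add0r !dotvE; lra.
Qed.

(** A gradient step of length [L^-1] lowers [f] by at least |grad f|^2 / (2 L), which minimality
    forbids unless the gradient vanishes. *)
Lemma grad_minimizer {R : realType} {d : nat} (f : 'rV[R]_d -> R) (L : R)
    (xs : 'rV[R]_d) : 0 < L -> lipschitz_smooth f L ->
  (forall z, f xs <= f z) -> grad f xs = 0.
Proof.
move=> L0 fL fmin; apply: dotvv_eq0.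
have /(le_trans (_ : 0 <= _)) := lipschitz_smooth_step f L L^-1 xs fL.
rewrite subr_ge0 => /(_ (fmin _)).
have -> : L^-1 * (1 - L * L^-1 / 2) = (2 * L)^-1.
  by field; rewrite gt_eqF.
rewrite mulNr oppr_ge0 pmulr_rle0 ?invr_gt0 ?mulr_gt0 // => h.
by apply/eqP; rewrite eq_le h dotvv_ge0.
Qed.

(* Smoothness gives [c * v >= 1 - L * a / 2] for the violation [v] at a rejected
   step [a], so the shrunk step is at least [2 * (1 - c) * rho / L]. *)
Lemma abls_step_bounds {R : realType} {d : nat} (f : 'rV[R]_d -> R)
    (L c rho eps : R) (x : 'rV[R]_d) (a b : R) :
  0 < L -> lipschitz_smooth f L -> 0 < c < 1 -> 0 < rho ->
  (forall v : R, v < 1 -> 0 < rhohat c rho eps v < 1) ->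
  abls f c rho eps x (- grad f x) a b ->
  2 * (1 - c) * rho / L <= a ->
  [/\ armijo f c x (- grad f x) b, 2 * (1 - c) * rho / L <= b & b <= a].
Proof.
move=> L0 fL /andP[c0 c1] rho0 hrho; elim=> {a b} [a arm la|a b narm _ IH la].
  by split.
have lb0 : 0 < 2 * (1 - c) * rho / L.
  by rewrite divr_gt0 // mulr_gt0 // mulr_gt0 // subr_gt0.
have a0 : 0 < a by exact: lt_le_trans la.
(* At a zero gradient the Armijo test reads 0 <= 0 and passes, so a rejected step has a nonzero
   denominator in its violation. *)
have gg0 : 0 < dotv (grad f x) (grad f x).
  rewrite lt_neqAle dotvv_ge0 andbT eq_sym; apply/eqP => /dotvv_eq0 g0.
  by apply: narm; rewrite /armijo g0 oppr0 scaler0 addr0 subrr /dotv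
    big1 ?mulr0 // => i _; rewrite mxE mul0r.
set v := violation f c x (- grad f x) a in IH *.
have D0 : 0 < c * a * dotv (grad f x) (grad f x) by rewrite !mulr_gt0.
have vE : f (x + a *: - grad f x) - f x
    = - v * (c * a * dotv (grad f x) (grad f x)).
  by rewrite /v /violation dotvNr mulrN; field; rewrite !gt_eqF.
have v1 : v < 1.
  rewrite ltNge; apply/negP => v1; apply: narm.
  rewrite /armijo vE dotvNr mulrN mulNr lerN2.
  by rewrite ler_peMl // ltW.
have cv0 : 0 < 1 - c * v by rewrite subr_gt0; nra.
have cvL : 1 - c * v <= L * a / 2.
  have := lipschitz_smooth_step f L a x fL; rewrite vE.
  rewrite (_ : - v * _ = - (a * (c * v)) * dotv (grad f x) (grad f x));
    last by ring.
  by rewrite ler_pM2r // lerN2 ler_pM2l //; lra.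
have /andP[r0 r1] := hrho v v1.
have la' : 2 * (1 - c) * rho / L <= rhohat c rho eps v * a.
  apply: (@le_trans _ _ (rho * ((1 - c) / (1 - c * v)) * a)).
    rewrite (_ : rho * _ * a = rho * (1 - c) * a / (1 - c * v)); last by ring.
    rewrite ler_pdivlMr // mulrAC ler_pdivrMr //.
    have k0 : 0 <= 2 * (1 - c) * rho by rewrite !mulr_ge0 ?subr_ge0 // ltW.
    by have := ler_wpM2l k0 cvL; lra.
  by rewrite ler_pM2r // /rhohat le_max lexx orbT.
have [arm lb ba] := IH la'; split=> //.
by apply: (le_trans ba); rewrite ler_piMl // ltW.
Qed.

(** * The Lyapunov function: contraction and change of condition number *)

Lemma momentumE (R : realType) (m l : R) : 0 < m -> 0 < l ->
  momentum m l = (Num.sqrt (l / m) - 1) / (Num.sqrt (l / m) + 1).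
Proof.
move=> m0 l0; rewrite /momentum.
have sm : 0 < Num.sqrt m by rewrite sqrtr_gt0.
have -> : Num.sqrt l = Num.sqrt (l / m) * Num.sqrt m.
  by rewrite -sqrtrM ?divr_ge0 ?ltW // divfK // gt_eqF.
have : 0 < Num.sqrt (l / m) by rewrite sqrtr_gt0 divr_gt0.
move: (Num.sqrt (l / m)) (Num.sqrt m) sm => q s s0 q0.
by field; rewrite !gt_eqF // ?addr_gt0 ?mulr_gt0.
Qed.

(* Points and values are measured relative to the minimizer and the minimum. *)
Lemma lyapunov_contract {R : realType} {d : nat} (m q Fx Fy Fy' : R)
    (X Y Z W g : 'rV[R]_d) : 0 < m -> 1 <= q ->
  Fy' <= Fx - dotv g g / (2 * (m * q ^+ 2)) ->
  Fx - dotv g X + m / 2 * dotv X X <= 0 ->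
  Fx + dotv g (Y - X) <= Fy ->
  Z = q *: (X - (m * q ^+ 2)^-1 *: g) - (q - 1) *: Y ->
  W = X + q *: (X - Y) ->
  Fy' + m / 2 * dotv Z Z <= (1 - q^-1) * (Fy + m / 2 * dotv W W).
Proof.
move=> m0 q1 hy' hx hy ZE WE.
have q0 : 0 < q by apply: lt_le_trans q1.
have p0 : 0 < q^-1 by rewrite invr_gt0.
have p1 : 0 <= 1 - q^-1 by rewrite subr_ge0 invf_le1.
have e1 := ler_wpM2l (ltW p0) hx.
have e2 := ler_wpM2l p1 hy.
have e3 : 0 <= m / 2 * (q - 1) * dotv (X - Y) (X - Y).
  by rewrite !mulr_ge0 ?dotvv_ge0 ?subr_ge0 // ltW.
rewrite mulr0 in e1.
(* Up to the gradient term, [Z] is the convex combination [(1 - q^-1) W + q^-1 X]. Its defect of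
   convexity is the quantity in [e3], and the square of the gradient cancels the decrease in
   [hy']. *)
have -> : m / 2 * dotv Z Z = (1 - q^-1) * (m / 2 * dotv W W)
   + q^-1 * (m / 2 * dotv X X) - m / 2 * (q - 1) * dotv (X - Y) (X - Y)
   - (q^-1 * dotv g X - (1 - q^-1) * dotv g (Y - X))
   + dotv g g / (2 * (m * q ^+ 2)).
  rewrite ZE WE !dotvE (dotvC X g) (dotvC Y g) (dotvC Y X).
  by field; rewrite !gt_eqF.
lra.
Qed.

Lemma lyapunov_rescale {R : realType} {d : nat} (m r F : R)
    (Y Z W : 'rV[R]_d) : 0 < m -> 1 <= r ->
  m / 2 * dotv Y Y <= F ->
  W = r *: Z - (r - 1) *: Y ->
  F + m / 2 * dotv W W <= r ^+ 4 * (F + m / 2 * dotv Z Z).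
Proof.
move=> m0 r1 hF ->.
have r41 : 0 <= r ^+ 4 - 1 by rewrite subr_ge0 exprn_ege1.
have e1 := ler_wpM2l r41 hF.
(* Once [F] is replaced by its lower bound [m / 2 * dotv Y Y], this is exactly the right side minus
   the left side, factored as [r - 1] times a sum of squares. *)
have e2 : 0 <= m / 2 * ((r - 1) * (dotv (r *: Z + Y) (r *: Z + Y)
    + r ^+ 3 * dotv Z Z + (r ^+ 3 + r ^+ 2 + 1) * dotv Y Y)).
  have r0 : 0 <= r by apply: le_trans r1.
  rewrite mulr_ge0 ?divr_ge0 ?(ltW m0) // mulr_ge0 ?subr_ge0 //.
  by rewrite !addr_ge0 ?mulr_ge0 ?addr_ge0 ?dotvv_ge0 ?exprn_ge0.
move: e2; rewrite !dotvE (dotvC Y Z); nra.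
Qed.

(** * Bounds along the iterates of AGD with backtracking *)

(** Each search starts from the step returned before it, so the lower bound on steps passes along by
    induction. Steps only shrink, so the estimates grow and stay above [m]. *)
Lemma abls_estimates {R : realType} {d : nat} (f : 'rV[R]_d -> R)
    (L m c rho eps s0 : R) (x : nat -> 'rV[R]_d) (Lk : nat -> R) :
  0 < L -> lipschitz_smooth f L -> 0 < c < 1 -> 0 < rho ->
  (forall v : R, v < 1 -> 0 < rhohat c rho eps v < 1) ->
  2 * (1 - c) * rho / L <= s0 ->
  monotone_abls_estimates f c rho eps s0 x Lk -> m < Lk 0%N ->
  forall k, [/\ armijo f c (x k) (- grad f (x k)) (Lk k)^-1,
    Lk k <= L / (2 * (1 - c) * rho), Lk k <= Lk k.+1 & m < Lk k].
Proof.
move=> L0 fL hc rho0 hrho ls0 [abls0 ablsS] mL0.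
have lb0 : 0 < 2 * (1 - c) * rho / L.
  by rewrite divr_gt0 // mulr_gt0 // mulr_gt0 // subr_gt0; case/andP: hc.
have step k a := @abls_step_bounds _ _ f L c rho eps (x k) a (Lk k)^-1
  L0 fL hc rho0 hrho.
have arm k : armijo f c (x k) (- grad f (x k)) (Lk k)^-1 /\
    2 * (1 - c) * rho / L <= (Lk k)^-1.
  elim: k => [|k [_ IH]]; first by have [] := step _ _ abls0 ls0.
  by have [] := step _ _ (ablsS k) IH.
have Lk0 k : 0 < Lk k by rewrite -invr_gt0; apply: lt_le_trans (arm k).2.
have mono k : Lk k <= Lk k.+1.
  rewrite -lef_pV2 ?posrE //.
  by have [] := step _ _ (ablsS k) (arm k).2.
move=> k; split=> //; first exact: (arm k).1.
- by rewrite -[leRHS]invf_div -[Lk k]invrK lef_pV2 ?posrE ?invr_gt0 ?(arm k).2.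
- by elim: k => // k IH; apply: lt_le_trans (mono k).
Qed.

Lemma agd_step {R : realType} {d : nat} (f : 'rV[R]_d -> R)
    (m c l : R) (xs x y y' : 'rV[R]_d) :
  0 < m -> m < l -> strongly_convex f m -> 1 / 2 <= c ->
  armijo f c x (- grad f x) l^-1 -> y' = x - l^-1 *: grad f x ->
  let q := Num.sqrt (l / m) in
  let Z := q *: (y' - xs) - (q - 1) *: (y - xs) in
  let W := (x - xs) + q *: (x - y) in
  (f y' - f xs + m / 2 * dotv Z Z
    <= (1 - q^-1) * (f y - f xs + m / 2 * dotv W W) : Prop).
Proof.
move=> m0 ml [_ _ fm] hc arm yE q Z W.
have l0 : 0 < l by apply: lt_trans ml.
have qE : m * q ^+ 2 = l.
  by rewrite sqr_sqrtr ?divr_ge0 ?ltW // mulrC divfK // gt_eqF.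
apply: (@lyapunov_contract _ _ m q (f x - f xs) _ _ (x - xs) (y - xs) Z W
  (grad f x)) => //.
- rewrite -sqrtr1 /q ler_wsqrtr // ler_pdivlMr // mul1r ltW //.
- move: arm; rewrite qE /armijo scalerN -yE dotvNr.
  (* The excess of [c] over 1/2 is discarded, leaving the decrease |grad f|^2 / (2 l). *)
  have g0 : 0 <= (c - 1 / 2) * (l^-1 * dotv (grad f x) (grad f x)).
    by rewrite !mulr_ge0 ?dotvv_ge0 ?subr_ge0 ?invr_ge0 // ltW.
  by rewrite invfM; lra.
- have := fm x xs; rewrite normE_sqr -(opprB x xs) !dotvE; lra.
- have := fm x y; rewrite normE_sqr.
  have -> : y - xs - (x - xs) = y - x by rewrite opprB addrA subrK.
  have : 0 <= m / 2 * dotv (y - x) (y - x).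
    by rewrite mulr_ge0 ?dotvv_ge0 // divr_ge0 // ltW.
  lra.
- by rewrite qE /Z yE addrAC.
- by rewrite opprB addrA subrK.
Qed.

Theorem proposition15 (R : realType) (d : nat) (f : 'rV[R]_d -> R)
    (L m c rho eps s0 : R) (xstar : 'rV[R]_d)
    (x y : nat -> 'rV[R]_d) (Lk : nat -> R)
    (hL : 0 < L) (hm : 0 < m)
    (hsmooth : lipschitz_smooth f L)
    (hconvex : strongly_convex f m)
    (hxstar : forall z : 'rV[R]_d, f xstar <= f z)
    (hc : 1 / 2 <= c < 1)
    (hrho : 0 < rho < 1)
    (heps : 0 < eps)
    (* a failed Armijo test along a descent direction has violation < 1 *)
    (hrhohat : forall v : R, v < 1 -> 0 < rhohat c rho eps v < 1)
    (hs0 : 0 < s0)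
    (* the first tentative step-size is not below the ABLS lower bound *)
    (hs0L : 2 * (1 - c) * rho / L <= s0)
    (hinit : x 0%N = y 0%N)
    (hagd : agd f m Lk x y)
    (habls : monotone_abls_estimates f c rho eps s0 x Lk)
    (hL0 : m < Lk 0%N)
    (k : nat) :
  let Q := L / m in
  f (y k.+1) - f xstar <=
    ((Num.sqrt Q - Num.sqrt (2 * (1 - c) * rho)) / Num.sqrt Q) ^+ k *
    (Q ^+ 2 / (4 * (1 - c) ^+ 2 * rho ^+ 2)) *
    ((L + m) / 2) * normE (x 0%N - xstar) ^+ 2.
Proof.
move=> /=.
case/andP: hc => hc1 hc2; case/andP: hrho => rho0 rho1.
have c0 : 0 < c < 1 by rewrite hc2 andbT; lra.
have est := abls_estimates f L m c rho eps s0 x Lk hL hsmooth c0 rho0 hrhohat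
  hs0L habls hL0.
pose q k := Num.sqrt (Lk k / m).
pose s := 2 * (1 - c) * rho.
have s_gt0 : 0 < s by rewrite !mulr_gt0 // subr_gt0.
(* Uniform cap on every [q k]; the claimed rate is [1 - qb^-1] and the claimed constant is
   [qb ^+ 4]. *)
pose qb := Num.sqrt (L / m) / Num.sqrt s.
have Qgt0 : 0 < Num.sqrt (L / m) by rewrite sqrtr_gt0 divr_gt0.
have sqs0 : 0 < Num.sqrt s by rewrite sqrtr_gt0.
have Lk0 i : 0 < Lk i by have [_ _ _] := est i; apply: lt_trans.
have q1 i : 1 <= q i.
  have [_ _ _ ml] := est i.
  by rewrite -sqrtr1 /q ler_wsqrtr // ler_pdivlMr // mul1r ltW.
have q0 i : 0 < q i by apply: lt_le_trans (q1 i).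
have qS i : q i <= q i.+1.
  have [_ _ lS _] := est i.
  by rewrite /q ler_wsqrtr // ler_pM2r ?invr_gt0.
have qqb i : q i <= qb.
  have [_ lb _ _] := est i.
  rewrite /q /qb -sqrtrV ?(ltW s_gt0) // -sqrtrM ?divr_ge0 ?(ltW hL, ltW hm) //.
  rewrite ler_wsqrtr //.
  by rewrite mulrAC ler_pM2r ?invr_gt0.
have qb1 : 1 <= qb by apply: le_trans (qqb 0%N).
have qb0 : 0 < qb by apply: lt_le_trans qb1.
have rateE : (Num.sqrt (L / m) - Num.sqrt s) / Num.sqrt (L / m) = 1 - qb^-1.
  by rewrite /qb; field; rewrite !gt_eqF.
have constE : (L / m) ^+ 2 / (4 * (1 - c) ^+ 2 * rho ^+ 2) = qb ^+ 4.
  rewrite (exprM qb 2 2) /qb [X in _ = X ^+ 2]expr_div_n !sqr_sqrtr ?ltW ?divr_gt0 //.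
  by rewrite /s; field; rewrite !gt_eqF // subr_gt0.
rewrite -/s rateE constE normE_sqr.
have rate0 : 0 <= 1 - qb^-1 by rewrite subr_ge0 invf_le1.
have gx0 := grad_minimizer f L xstar hL hsmooth hxstar.
have gmin : forall z, m / 2 * dotv (z - xstar) (z - xstar) <= f z - f xstar.
  case: hconvex => _ _ fm z; have := fm xstar z.
  rewrite gx0 normE_sqr.
  rewrite /(dotv 0 _) big1 => [|i _]; last by rewrite mxE mul0r.
  lra.
pose Z i := q i *: (y i.+1 - xstar) - (q i - 1) *: (y i - xstar).
pose W i := (x i - xstar) + q i *: (x i - y i).
pose X0 := x 0%N - xstar.
pose Psi := (L + m) / 2 * dotv X0 X0.
(* With [x 0 = y 0] the momentum part of [W 0] vanishes; smoothness at the minimizer gives L/2 and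
   the quadratic term m/2. *)
have Psi0 : f (y 0%N) - f xstar + m / 2 * dotv (W 0%N) (W 0%N) <= Psi.
  have -> : W 0%N = X0 by rewrite /W hinit subrr scaler0 addr0 /X0 hinit.
  case: hsmooth => _ fL; have := fL xstar (y 0%N).
  rewrite gx0 normE_sqr.
  rewrite /(dotv 0 _) big1 => [|i _]; last by rewrite mxE mul0r.
  rewrite /Psi /X0 hinit; lra.
have contract i : f (y i.+1) - f xstar + m / 2 * dotv (Z i) (Z i)
    <= (1 - qb^-1) * (f (y i) - f xstar + m / 2 * dotv (W i) (W i)).
  have [arm _ _ ml] := est i; have [yE _] := hagd i.
  have := agd_step f m c (Lk i) xstar (x i) (y i) (y i.+1) hm ml hconvex hc1
    arm yE.
  move/le_trans; apply; rewrite ler_wpM2r //.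
    by rewrite addr_ge0 ?subr_ge0 // mulr_ge0 ?dotvv_ge0 // divr_ge0 // ltW.
  by rewrite lerD2l lerN2 lef_pV2 ?posrE ?[_ <= _]qqb // [_ < _]q0.
pose r i := (1 + q i.+1) / (1 + q i).
have rescale i : f (y i.+1) - f xstar + m / 2 * dotv (W i.+1) (W i.+1)
    <= r i ^+ 4 * (f (y i.+1) - f xstar + m / 2 * dotv (Z i) (Z i)).
  apply: (@lyapunov_rescale _ _ m _ _ (y i.+1 - xstar)) => //.
    by rewrite ler_pdivlMr ?addr_gt0 // mul1r lerD2l.
  (* Both sides equal [y i.+1 - xstar] plus a multiple of [y i.+1 - y i]; the multiples agree
     because the momentum is [(q i - 1) / (q i + 1)]. *)
  have [_ xE] := hagd i; rewrite /W /Z xE momentumE // -/(q i) /r.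
  apply/rowP => j; rewrite !mxE; field.
  by rewrite !gt_eqF // addr_gt0.
(* The product of the [r j] telescopes. The contraction of iteration 0 is weakened to a factor 1,
   hence exponent [i] at index [i.+1]. *)
have bound i : f (y i.+1) - f xstar + m / 2 * dotv (Z i) (Z i)
    <= (1 - qb^-1) ^+ i * (((1 + q i) / (1 + q 0%N)) ^+ 4 * Psi).
  elim: i => [|i IH].
    rewrite expr0 mul1r divff ?gt_eqF ?addr_gt0 // expr1n mul1r.
    apply: le_trans (contract 0%N) _; apply: le_trans Psi0.
    rewrite ler_piMl ?gerBl ?invr_ge0 ?(ltW qb0) //.
    by rewrite addr_ge0 ?subr_ge0 // mulr_ge0 ?dotvv_ge0 // divr_ge0 // ltW.
  apply: le_trans (contract i.+1) _.
  rewrite exprS -[leRHS]mulrA ler_wpM2l //.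
  apply: le_trans (rescale i) _.
  have r0 : 0 <= r i ^+ 4 by rewrite exprn_ge0 // divr_ge0 // addr_ge0 // ltW.
  apply: le_trans (ler_wpM2l r0 IH) _.
  have -> : (1 + q i.+1) / (1 + q 0%N) = r i * ((1 + q i) / (1 + q 0%N)).
    by rewrite /r; field; rewrite !gt_eqF ?addr_gt0.
  by rewrite [in leRHS]exprMn mulrCA -(mulrA (r i ^+ 4)) lexx.
have Psi_ge0 : 0 <= Psi.
  by rewrite mulr_ge0 ?dotvv_ge0 // divr_ge0 // addr_ge0 ?ltW.
apply: le_trans (_ : _ <= f (y k.+1) - f xstar + m / 2 * dotv (Z k) (Z k)) _.
  by rewrite lerDl mulr_ge0 ?dotvv_ge0 // divr_ge0 // ltW.
apply: le_trans (bound k) _; rewrite -[leRHS]mulrA -[leRHS]mulrA.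
rewrite ler_wpM2l ?exprn_ge0 // -/X0 -/Psi.
rewrite ler_wpM2r // lerXn2r ?nnegrE ?divr_ge0 ?addr_ge0 ?(ltW (q0 _)) ?(ltW qb0) //.
(* The ratio is at most [qb] because [1 + q k <= 1 + qb <= qb * (1 + q 0)], using [1 <= q 0] and
   [1 <= qb]. *)
rewrite ler_pdivrMr ?addr_gt0 //.
have := qqb k; have := q1 0%N; nra.
Qed.
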